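(* For all integers $1\leq k\leq n$: (i) $A_{n,k}=B_{n,k}(A_{1,1},A_{2,1},\ldots,A_{n-k+1,1})$; (ii) $B_{n,k}=A_{n,k}(A_{1,1},A_{2,1},\ldots,A_{n-k+1,1})$.
   Context: Let $R=\mathbb{Z}[X_1,X_1^{-1},X_2,X_3,\ldots]$. For $P\in R$ and $Y_1,Y_2,\ldots\in R$ with $Y_1$ a unit of $R$, $P(Y_1,Y_2,\ldots)$ denotes the image of $P$ under the ring homomorphism $X_i\mapsto Y_i$. Partial exponential Bell polynomials: $B_{0,0}=1$, $B_{n,0}=0$ for $n\geq1$, $B_{n,k}=0$ for $0\leq n<k$, and for $1\leq k\leq n$, $B_{n,k}=\sum \frac{n!}{r_1!\cdots r_{n-k+1}!\,(1!)^{r_1}\cdots((n-k+1)!)^{r_{n-k+1}}}X_1^{r_1}\cdots X_{n-k+1}^{r_{n-k+1}}$, summed over nonnegative integers $r_i$ with $\sum r_i=k$, $\sum i r_i=n$. Elements $S_{n,k}\in R$: $S_{0,0}=X_1^{-1}$, $S_{n,0}=0$ ($n\geq1$), $S_{n,k}=0$ ($0\leq n<k$), and for $n\geq0$, $1\leq k\leq n+1$: $S_{n+1,k}=-(2n-1)X_2S_{n,k}+X_1\big(S_{n,k-1}+\sum_{j=1}^{n-k+1}X_{j+1}\,\partial S_{n,k}/\partial X_j\big)$. Set $A_{n,k}:=X_1^{-(2n-1)}S_{n,k}$ (note $A_{1,1}=X_1^{-1}$). *)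

(* Defs.v *)
From HB Require Import structures.
From mathcomp Require Import all_boot all_order all_algebra.
From mathcomp Require Import finmap.
From mathcomp.multinomials Require Import monalg.
From Stdlib Require Import ClassicalEpsilon.

Set Implicit Arguments.
Unset Strict Implicit.
Unset Printing Implicit Defensive.

Import GRing.Theory Num.Theory.
Local Open Scope fset_scope.
Local Open Scope ring_scope.

(* The library gives [{malg int[M]}] a ring structure only for a [monomType] M,
   and these have no nontrivial invertible elements; hence the convolution
   product is redone here for monomials in which X_1 has an exponent in Z.

   [(e, m) : lmonom] is X_1 ^ e * \prod_i X_(i + 2) ^ (m i).                  *)
Definition lmonom : Type := (int * {cmonom nat})%type.
HB.instance Definition _ := Choice.on lmonom.

Definition lmone : lmonom := (0, mone).
Definition lmmul (m1 m2 : lmonom) : lmonom := (m1.1 + m2.1, mmul m1.2 m2.2).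

(* Z[X_1, X_1^-1, X_2, X_3, ...] *)
Definition laurent : Type := {malg int[lmonom]}.
HB.instance Definition _ := GRing.Zmodule.on laurent.

Definition lterm (c : int) (m : lmonom) : laurent := << c *g m >>.

Section LaurentRing.
Implicit Types (g : laurent) (m : lmonom) (c : int).

Lemma lterm0 m : lterm 0 m = 0.
Proof. exact: monalgU0. Qed.

Lemma ltermD m : {morph lterm^~ m : c1 c2 / c1 + c2}.
Proof. exact: monalgUD. Qed.

Lemma lmmulA : associative lmmul.
Proof. by move=> x y z; rewrite /lmmul /= addrA mulmA. Qed.

Lemma lmmulC : commutative lmmul.
Proof. by move=> x y; rewrite /lmmul addrC mulmC. Qed.

Lemma lmmul1m : left_id lmone lmmul.
Proof. by case=> e m; rewrite /lmmul /= add0r mul1m. Qed.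

Definition lone : laurent := lterm 1 lmone.

Definition lmul g1 g2 : laurent :=
  \sum_(m1 <- msupp g1) \sum_(m2 <- msupp g2)
     lterm (g1@_m1 * g2@_m2) (lmmul m1 m2).

Lemma lmulw (d1 d2 : {fset lmonom}) g1 g2 :
    msupp g1 `<=` d1 -> msupp g2 `<=` d2 ->
  lmul g1 g2 = \sum_(m1 <- d1) \sum_(m2 <- d2)
                 lterm (g1@_m1 * g2@_m2) (lmmul m1 m2).
Proof.
move=> le1 le2; rewrite /lmul (big_fset_incl _ le1) /=.
  apply/eq_bigr=> m1 _; apply/big_fset_incl => // m _ /mcoeff_outdom ->.
  by rewrite mulr0 lterm0.
move=> m _ /mcoeff_outdom g1m.
by rewrite big1 // => m' _; rewrite g1m mul0r lterm0.
Qed.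

Lemma lmulC : commutative lmul.
Proof.
move=> g1 g2; rewrite /lmul exchange_big /=.
by apply/eq_bigr=> m2 _; apply/eq_bigr=> m1 _; rewrite mulrC lmmulC.
Qed.

Lemma lmulDl : left_distributive lmul +%R.
Proof.
move=> g1 g2 g.
rewrite [in RHS](lmulw (fsubsetUl _ (msupp g2)) (fsubset_refl _)).
rewrite [in RHS](lmulw (fsubsetUr (msupp g1) _) (fsubset_refl _)).
rewrite (lmulw (msuppD_le _ _) (fsubset_refl _)).
rewrite -big_split /=; apply/eq_bigr=> m1 _.
rewrite -big_split /=; apply/eq_bigr=> m2 _.
by rewrite mcoeffD mulrDl ltermD.
Qed.

Lemma lmulDr : right_distributive lmul +%R.
Proof. by move=> g g1 g2; rewrite lmulC lmulDl ![lmul _ g]lmulC. Qed.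

Lemma lmul0g : left_zero (0 : laurent) lmul.
Proof. by move=> g; rewrite /lmul msupp0 big_seq_fset0. Qed.

Lemma lmulg0 : right_zero (0 : laurent) lmul.
Proof. by move=> g; rewrite lmulC lmul0g. Qed.

Lemma lmulUU c1 c2 m1 m2 :
  lmul (lterm c1 m1) (lterm c2 m2) = lterm (c1 * c2) (lmmul m1 m2).
Proof. by rewrite (lmulw msuppU_le msuppU_le) !big_seq_fset1 !mcoeffUU. Qed.

Lemma laurentE g : g = \sum_(m <- msupp g) lterm g@_m m.
Proof. exact: monalgE. Qed.

Lemma lmul_suml I (s : seq I) (F : I -> laurent) g :
  lmul (\sum_(i <- s) F i) g = \sum_(i <- s) lmul (F i) g.
Proof. by rewrite (big_morph (lmul^~ g) (fun _ _ => lmulDl _ _ _) (lmul0g g)). Qed.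

Lemma lmul_sumr I (s : seq I) (F : I -> laurent) g :
  lmul g (\sum_(i <- s) F i) = \sum_(i <- s) lmul g (F i).
Proof. by rewrite (big_morph (lmul g) (fun _ _ => lmulDr _ _ _) (lmulg0 g)). Qed.

Lemma lmulA : associative lmul.
Proof.
move=> g1 g2 g3; rewrite (laurentE g1) !lmul_suml; apply/eq_bigr=> m1 _.
rewrite (laurentE g2) !(lmul_suml, lmul_sumr); apply/eq_bigr=> m2 _.
rewrite (laurentE g3) !lmul_sumr; apply/eq_bigr=> m3 _.
by rewrite !lmulUU mulrA lmmulA.
Qed.

Lemma lmul1g : left_id lone lmul.
Proof.
move=> g; rewrite (laurentE g) lmul_sumr; apply/eq_bigr=> m _.
by rewrite lmulUU mul1r lmmul1m.
Qed.

Lemma lone_neq0 : lone != 0.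
Proof. by apply/eqP/malgP=> /(_ lmone)/eqP; rewrite mcoeffUU mcoeff0. Qed.

HB.instance Definition _ := GRing.Zmodule_isComNzRing.Build laurent
  lmulA lmulC lmul1g lmulDl lone_neq0.

Lemma laurentUU c1 c2 m1 m2 :
  lterm c1 m1 * lterm c2 m2 =
  lterm (c1 * c2) (lmmul m1 m2).
Proof. exact: lmulUU. Qed.

Definition lunit : {pred laurent} :=
  fun g => if excluded_middle_informative (exists h, h * g = 1)
           then true else false.

Definition linv g : laurent :=
  if excluded_middle_informative (exists h, h * g = 1) is left hg
  then sval (constructive_indefinite_description _ hg) else g.

Lemma lmulVr : {in lunit, left_inverse 1 linv *%R}.
Proof.
move=> g; rewrite unfold_in /lunit /linv.
by case: excluded_middle_informative => // hg _; case: constructive_indefinite_description.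
Qed.

Lemma lunitPl g h : h * g = 1 -> lunit g.
Proof.
move=> hg; rewrite /lunit.
by case: excluded_middle_informative => // nh; case: nh; exists h.
Qed.

Lemma linv_out : {in [predC lunit], linv =1 id}.
Proof.
move=> g; rewrite inE /= unfold_in /lunit /linv.
by case: excluded_middle_informative.
Qed.

HB.instance Definition _ := GRing.ComNzRing_hasMulInverse.Build laurent
  lmulVr lunitPl linv_out.

End LaurentRing.

(* Variables are numbered from 1; the value at 0 is junk. *)
Definition X (i : nat) : laurent :=
  match i with
  | 0 => 0
  | 1 => lterm 1 (1, mone)
  | j.+2 => lterm 1 (0, @ucm _ j)
  end.

Definition lmeval (Y : nat -> laurent) (m : lmonom) : laurent :=
  Y 1%N ^ m.1 * \prod_(i <- finsupp m.2) Y i.+2 ^+ m.2 i.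

(* P(Y_1, Y_2, ...), for Y_1 a unit. *)
Definition leval (Y : nat -> laurent) (P : laurent) : laurent :=
  mmap intr (lmeval Y) P.

(* X_i * d(m)/dX_i = (lmexp i m) m, and [lmdec i m] is m / X_i. When X_i,
   i >= 2, does not occur in m, [lmdec i m] is junk but [lmexp i m] is 0.     *)
Definition lmexp (i : nat) (m : lmonom) : int :=
  match i with
  | 0 => 0
  | 1 => m.1
  | j.+2 => (m.2 j)%:Z
  end.

Definition lmdec (i : nat) (m : lmonom) : lmonom :=
  match i with
  | 0 => m
  | 1 => (m.1 - 1, m.2)
  | j.+2 => (m.1, @divcm _ m.2 (@ucm _ j))
  end.

Definition pderiv (i : nat) (P : laurent) : laurent :=
  mmap intr (fun m => lterm (lmexp i m) (lmdec i m)) P.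

(* Partial exponential Bell polynomials; r i is the multiplicity of X_(i + 1),
   it is at most k because the r i add up to k, and the division is exact.    *)
Definition Bpoly (n k : nat) : laurent :=
  if k == 0%N then (n == 0%N)%:R
  else if (n < k)%N then 0
  else \sum_(r : {ffun 'I_(n - k + 1) -> 'I_k.+1} |
              ((\sum_i r i)%N == k) && ((\sum_(i < n - k + 1) i.+1 * r i)%N == n))
         (n`! %/ \prod_(i < n - k + 1) ((r i)`! * i.+1`! ^ r i))%N%:R *
         \prod_(i < n - k + 1) X i.+1 ^+ r i.

(* j ranges over 1 <= j <= n' - k + 1, an empty range when k = n' + 1. *)
Fixpoint Spoly (n k : nat) : laurent :=
  match n with
  | 0 => if k == 0%N then (X 1)^-1 else 0
  | n'.+1 =>
      if (k == 0%N) || (n < k)%N then 0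
      else - (2 * n'%:Z - 1)%:~R * X 2 * Spoly n' k +
           X 1 * (Spoly n' k.-1 +
                  \sum_(1 <= j < n'.+2 - k) X j.+1 * pderiv j (Spoly n' k))
  end.

Definition Apoly (n k : nat) : laurent := X 1 ^ (- (2 * n%:Z - 1)) * Spoly n k.

Section EvalDeriv.
Implicit Types (Y : nat -> laurent) (P Q : laurent) (m : lmonom).

Lemma X1_unit : X 1 \is a GRing.unit.
Proof.
apply/unitrP; exists (lterm 1 (-1, mone)).
rewrite /X !laurentUU /lmmul /= mulr1 mul1m addNr subrr.
by split.
Qed.

Lemma lmevalw Y m (d : {fset nat}) : finsupp m.2 `<=` d ->
  lmeval Y m = Y 1%N ^ m.1 * \prod_(i <- d) Y i.+2 ^+ m.2 i.
Proof.
move=> le; congr (_ * _); apply: big_fset_incl => // i _.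
by rewrite -cmE_eq0 => /eqP ->.
Qed.

Lemma lmevalM Y m1 m2 : Y 1%N \is a GRing.unit ->
  lmeval Y (lmmul m1 m2) = lmeval Y m1 * lmeval Y m2.
Proof.
move=> Yu; set d := finsupp m1.2 `|` finsupp m2.2.
rewrite !(@lmevalw Y _ d) ?fsubsetUl ?fsubsetUr //=; last by rewrite mdomD.
rewrite exprzDr // mulrACA -big_split /=; congr (_ * _).
by apply: eq_bigr=> i _; rewrite cmM exprD.
Qed.

Lemma leval_additive Y : {morph leval Y : P Q / P + Q}.
Proof. exact: mmapD. Qed.

Lemma levalU Y c m : leval Y (lterm c m) = c%:~R * lmeval Y m.
Proof. exact: mmapU. Qed.

Lemma leval1 Y : leval Y 1 = 1.
Proof.
rewrite levalU mul1r /lmeval expr0z mul1r big1 // => i _.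
by rewrite cm1 expr0.
Qed.

Lemma leval_sum Y I (s : seq I) (F : I -> laurent) :
  leval Y (\sum_(i <- s) F i) = \sum_(i <- s) leval Y (F i).
Proof. exact: (big_morph _ (leval_additive Y) (mmap0 (h := lmeval Y))). Qed.

Lemma levalM Y : Y 1%N \is a GRing.unit -> {morph leval Y : P Q / P * Q}.
Proof.
move=> Yu P Q; rewrite (laurentE P) mulr_suml 2!leval_sum mulr_suml.
apply: eq_bigr=> m1 _; rewrite (laurentE Q) mulr_sumr 2!leval_sum mulr_sumr.
apply: eq_bigr=> m2 _.
by rewrite laurentUU !levalU lmevalM // intrM mulrACA.
Qed.

Lemma levalX Y i : (0 < i)%N -> leval Y (X i) = Y i.
Proof.
case: i => [|[|i]] // _; rewrite levalU mul1r /lmeval /=.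
  by rewrite expr1z big1 ?mulr1 // => i _; rewrite cm1 expr0.
by rewrite expr0z mul1r mdomU big_seq_fset1 cmUU expr1.
Qed.

Lemma pderiv_additive i : {morph pderiv i : P Q / P + Q}.
Proof. exact: mmapD. Qed.

Lemma pderivU i c m :
  pderiv i (lterm c m) = c%:~R * lterm (lmexp i m) (lmdec i m).
Proof. exact: mmapU. Qed.

Lemma pderiv_sum i I (s : seq I) (F : I -> laurent) :
  pderiv i (\sum_(j <- s) F j) = \sum_(j <- s) pderiv i (F j).
Proof. exact: (big_morph _ (pderiv_additive i) (mmap0 (h := fun m => lterm _ _))). Qed.

Lemma lmexpM i m1 m2 : lmexp i (lmmul m1 m2) = lmexp i m1 + lmexp i m2.
Proof. by case: i => [|[|i]] //=; rewrite cmM. Qed.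

Lemma lmdecM i m1 m2 : lmexp i m1 != 0 ->
  lmdec i (lmmul m1 m2) = lmmul (lmdec i m1) m2.
Proof.
case: i => [|[|i]] //= m1i; rewrite /lmmul /=; first by rewrite addrAC.
congr (_, _); apply/eqP/cmP => j; rewrite divcmE !cmM divcmE cmU.
by case: eqVneq => [<-|_]; rewrite ?subn0 // addnBAC // lt0n.
Qed.

Lemma lterm_lmdecM i m1 m2 :
  lterm (lmexp i m1) (lmdec i (lmmul m1 m2)) =
  lterm (lmexp i m1) (lmdec i m1) * lterm 1 m2.
Proof.
have [->|m1i] := eqVneq (lmexp i m1) 0; first by rewrite !lterm0 mul0r.
by rewrite laurentUU mulr1 lmdecM.
Qed.

Lemma ltermE c m : lterm c m = c%:~R * lterm 1 m.
Proof.
rewrite mulrzl -[in LHS](intz c).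
exact: (raddfMz (@mkmalgU lmonom int m) c 1).
Qed.

Lemma pderivM i P Q : pderiv i (P * Q) = pderiv i P * Q + P * pderiv i Q.
Proof.
rewrite (laurentE P) mulr_suml 2!pderiv_sum !mulr_suml -big_split /=.
apply: eq_bigr=> m1 _; rewrite (laurentE Q) mulr_sumr 2!pderiv_sum !mulr_sumr.
rewrite -big_split /=; apply: eq_bigr=> m2 _; move: P@__ Q@__ => c d.
rewrite laurentUU !pderivU lmexpM ltermD {2}lmmulC !lterm_lmdecM intrM.
have key (R : comNzRingType) (a b u v x y : R) :
    a * b * (u * x + v * y) = a * u * (b * x) + a * y * (b * v).
  by rewrite mulrDr [v * y]mulrC; congr (_ + _); rewrite mulrACA.
by rewrite (ltermE c m1) (ltermE d m2) key.
Qed.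

Lemma pderivX i j : (0 < i)%N -> (0 < j)%N -> pderiv i (X j) = (i == j)%:R.
Proof.
case: i j => [|[|i]] [|[|j]] // _ _; rewrite pderivU mul1r /= ?lterm0 //.
- by rewrite cm1 lterm0.
- rewrite cmU eq_sym !eqSS; case: eqVneq => [->|_]; last by rewrite lterm0.
  congr lterm; congr (_, _).
  by apply/eqP/cmP => k; rewrite divcmE subnn cm1.
Qed.
End EvalDeriv.

(* Main.v *)
(* Let D be the derivation X_j |-> X_(j + 1). Both families obey a recurrence:
   B_(n+1,k) = X_1 B_(n,k-1) + D B_(n,k) and
   A_(n+1,k) = X_1^-1 (A_(n,k-1) + D A_(n,k)).
   Let phi be the substitution X_j |-> A_(j,1). The second recurrence with
   k = 1 says that phi D = X_1^-1 D phi on the variables, hence everywhere, so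
   phi(B_(n,k)) obeys the recurrence of A_(n,k): this is (i). Moreover phi phi
   commutes with D and fixes X_1, so phi is an involution, which gives (ii).
   The recurrence for B follows from d B_(n,k) / d X_i = C(n,i) B_(n-i,k-1) and
   the Euler identity sum_i i X_i d B_(n,k) / d X_i = n B_(n,k), both read off
   from the coefficients. *)

Require Import Defs.
From mathcomp Require Import all_boot all_order all_algebra.
From mathcomp Require Import finmap ring.
From mathcomp.multinomials Require Import monalg.

Set Implicit Arguments.
Unset Strict Implicit.
Unset Printing Implicit Defensive.

Import Order.TTheory GRing.Theory Num.Theory.
Local Open Scope ring_scope.

(** * Elements that involve only the first [n] variables *)

Arguments X : simpl never.

(* The subring Z[X_1, X_1^-1, X_2, ..., X_n]. *)
Inductive in_vars (n : nat) : laurent -> Prop :=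
| in_vars_X i of (0 < i <= n)%N : in_vars n (X i)
| in_vars_V of (0 < n)%N : in_vars n (X 1)^-1
| in_vars_1 : in_vars n 1
| in_vars_N P of in_vars n P : in_vars n (- P)
| in_vars_D P Q of in_vars n P & in_vars n Q : in_vars n (P + Q)
| in_vars_M P Q of in_vars n P & in_vars n Q : in_vars n (P * Q).

Lemma in_vars_mono m n P : (m <= n)%N -> in_vars m P -> in_vars n P.
Proof.
move=> mn; elim=> [i /andP[i0 im]|m0||{}P _ IH|{}P Q _ IHP _ IHQ|{}P Q _ IHP _ IHQ].
- by apply: in_vars_X; rewrite i0 (leq_trans im mn).
- by apply: in_vars_V; apply: leq_trans mn.
- exact: in_vars_1.
- exact: in_vars_N.
- exact: in_vars_D.
- exact: in_vars_M.
Qed.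

Lemma in_vars0 n : in_vars n 0.
Proof.
by rewrite -[0](subrr 1); apply/in_vars_D/in_vars_N; apply: in_vars_1.
Qed.

Lemma in_vars_sum n I (s : seq I) (p : pred I) (F : I -> laurent) :
  (forall i, p i -> in_vars n (F i)) -> in_vars n (\sum_(i <- s | p i) F i).
Proof. by move=> H; elim/big_ind: _ => //; [exact: in_vars0|exact: in_vars_D]. Qed.

Lemma in_vars_prod n I (s : seq I) (p : pred I) (F : I -> laurent) :
  (forall i, p i -> in_vars n (F i)) -> in_vars n (\prod_(i <- s | p i) F i).
Proof. by move=> H; elim/big_ind: _ => //; [exact: in_vars_1|exact: in_vars_M]. Qed.

Lemma in_vars_exp n P k : in_vars n P -> in_vars n (P ^+ k).
Proof.
move=> HP; elim: k => [|k IH]; first exact: in_vars_1.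
by rewrite exprS; apply: in_vars_M.
Qed.

Lemma in_vars_nat n k : in_vars n k%:R.
Proof.
elim: k => [|k IH]; first exact: in_vars0.
by rewrite -natr1; apply/in_vars_D/in_vars_1.
Qed.

Lemma in_vars_int n (z : int) : in_vars n z%:~R.
Proof. by case: z => k; do ?apply: in_vars_N; apply: in_vars_nat. Qed.

Lemma in_vars_X1z n (z : int) : (0 < n)%N -> in_vars n (X 1 ^ z).
Proof.
move=> n0; case: z => k; first by apply/in_vars_exp/in_vars_X.
by rewrite NegzE -invr_expz -exprVn; apply/in_vars_exp/in_vars_V.
Qed.

Lemma X1zE (z : int) : X 1 ^ z = lterm 1 (z, mone).
Proof.
elim/int_rec: z => [|k IH|k IH] //.
  by rewrite exprSzr IH laurentUU /lmmul /= mulm1 mulr1 addrC -intS.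
rewrite -[-(k.+1%:Z)]/(- (k.+1%:Z)) intS opprD addrC exprzDr ?X1_unit // IH.
suff -> : X 1 ^ (-1) = lterm 1 (-1, mone).
  by rewrite laurentUU /lmmul /= mulm1 mulr1.
rewrite exprN1; apply: (mulrI X1_unit); rewrite divrr ?X1_unit //.
by rewrite laurentUU /lmmul /= subrr mulm1 mulr1.
Qed.

Lemma pderiv1_X1z (z : int) : pderiv 1 (X 1 ^ z) = z%:~R * X 1 ^ (z - 1).
Proof. by rewrite !X1zE pderivU mul1r ltermE. Qed.

(** * Derivations and ring morphisms determined on the variables *)

(** Applied to the difference of two derivations twisted by the same [f], this reduces an identity
    between them to the variables; [f = id] is the ordinary case. *)
Lemma twisted_derivation_eq0 n (f e : laurent -> laurent) :
    {morph f : P Q / P * Q} -> f 1 = 1 ->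
    {morph e : P Q / P + Q} ->
    (forall P Q, e (P * Q) = e P * f Q + f P * e Q) ->
    (forall i, (0 < i <= n)%N -> e (X i) = 0) ->
  forall P, in_vars n P -> e P = 0.
Proof.
move=> fM f1 eD eM eX.
have e0 : e 0 = 0.
  by apply: (addrI (e 0)); rewrite -eD !addr0.
have e1 : e 1 = 0.
  by apply: (addrI (e 1)); rewrite -[1 in RHS]mulr1 eM f1 mulr1 mul1r addr0.
move=> P; elim=> [i /eX//|n0||{}P _ IH|{}P Q _ IHP _ IHQ|{}P Q _ IHP _ IHQ] //.
(* The Leibniz rule on X_1^-1 X_1 = 1 leaves e(X_1^-1) f(X_1) = 0, and f(X_1) has the inverse
   f(X_1^-1). *)
- have := eM (X 1)^-1 (X 1); rewrite mulVr ?X1_unit // e1 (eX 1%N) // mulr0 addr0.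
  move=> /(congr1 (fun u => u * f (X 1)^-1)).
  by rewrite mul0r -mulrA -fM divrr ?X1_unit // f1 mulr1.
- by apply: (addrI (e P)); rewrite -eD subrr e0 IH addr0.
- by rewrite eD IHP IHQ addr0.
- by rewrite eM IHP IHQ mul0r mulr0 addr0.
Qed.

Lemma ring_morph_eq n (f g : laurent -> laurent) :
    {morph f : P Q / P * Q} -> {morph f : P Q / P + Q} -> f 1 = 1 ->
    {morph g : P Q / P * Q} -> {morph g : P Q / P + Q} -> g 1 = 1 ->
    (forall i, (0 < i <= n)%N -> f (X i) = g (X i)) ->
  forall P, in_vars n P -> f P = g P.
Proof.
move=> fM fD f1 gM gD g1 fgX.
have f0 : f 0 = 0 by apply: (addrI (f 0)); rewrite -fD !addr0.
have g0 : g 0 = 0 by apply: (addrI (g 0)); rewrite -gD !addr0.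
move=> P; elim=> [i /fgX//|n0||{}P _ IH|{}P Q _ IHP _ IHQ|{}P Q _ IHP _ IHQ].
- rewrite -[LHS]mulr1 -g1 -(divrr X1_unit) gM -fgX // mulrA -fM.
  by rewrite mulVr ?X1_unit // f1 mul1r.
- by rewrite f1 g1.
- by apply: (addrI (f P)); rewrite -fD subrr f0 IH -gD subrr g0.
- by rewrite fD gD IHP IHQ.
- by rewrite fM gM IHP IHQ.
Qed.

Lemma pderiv_notin n j P : (n < j)%N -> in_vars n P -> pderiv j P = 0.
Proof.
move=> nj; apply: (@twisted_derivation_eq0 n id) => //.
- exact: pderiv_additive.
- exact: pderivM.
- move=> i /andP[i0 ilen]; rewrite pderivX ?(leq_trans _ nj) //.
  by rewrite gtn_eqF // (leq_ltn_trans ilen).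
Qed.

Lemma pderiv_1 j : pderiv j 1 = 0.
Proof.
by apply: (addrI (pderiv j 1)); rewrite -[1 in RHS]mulr1 pderivM mulr1 mul1r addr0.
Qed.

Lemma pderiv_0 j : pderiv j 0 = 0.
Proof. by apply: (addrI (pderiv j 0)); rewrite -pderiv_additive !addr0. Qed.

Lemma in_vars_pderiv n j P : in_vars n P -> in_vars n (pderiv j P).
Proof.
case: j => [|j].
  (* Index 0 names no variable: [lmexp 0] is 0, so every term vanishes. *)
  move=> _; suff -> : pderiv 0 P = 0 by exact: in_vars0.
  by rewrite (laurentE P) pderiv_sum big1 // => m _; rewrite pderivU lterm0 mulr0.
elim=> [i /andP[i0 _]|n0||{}P HP IH|{}P Q _ IHP _ IHQ|{}P Q HP IHP HQ IHQ].
- by rewrite pderivX //; apply: in_vars_nat.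
- case: j => [|j].
    rewrite -exprN1 pderiv1_X1z; apply: in_vars_M; first exact: in_vars_int.
    exact: in_vars_X1z.
  rewrite (@pderiv_notin 1) //; [exact: in_vars0|exact: in_vars_V].
- by rewrite pderiv_1; apply: in_vars0.
- suff -> : pderiv j.+1 (- P) = - pderiv j.+1 P by exact: in_vars_N.
  by apply: (addrI (pderiv j.+1 P)); rewrite -pderiv_additive !subrr pderiv_0.
- by rewrite pderiv_additive; apply: in_vars_D.
- by rewrite pderivM; apply: in_vars_D; apply: in_vars_M.
Qed.

(* The derivation X_j |-> X_(j + 1), cut off at j = N. *)
Definition shiftD (N : nat) (P : laurent) : laurent :=
  \sum_(1 <= j < N.+1) X j.+1 * pderiv j P.

Lemma shiftD_additive N : {morph shiftD N : P Q / P + Q}.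
Proof.
move=> P Q; rewrite /shiftD -big_split; apply: eq_bigr => j _ /=.
by rewrite pderiv_additive mulrDr.
Qed.

Lemma shiftDM N P Q : shiftD N (P * Q) = shiftD N P * Q + P * shiftD N Q.
Proof.
rewrite /shiftD mulr_suml mulr_sumr -big_split; apply: eq_bigr => j _ /=.
by rewrite pderivM mulrDr mulrA [P * (_ * _)]mulrCA.
Qed.

Lemma shiftD0 N : shiftD N 0 = 0.
Proof. by rewrite /shiftD big1 // => j _; rewrite pderiv_0 mulr0. Qed.

Lemma shiftDX N i : (0 < i <= N)%N -> shiftD N (X i) = X i.+1.
Proof.
case/andP=> i0 iN; rewrite /shiftD (bigD1_seq i) ?iota_uniq ?mem_index_iota ?ltnS ?i0 //=.
rewrite pderivX // eqxx mulr1 big_nat_cond big1 ?addr0 // => j /andP[/andP[j0 _] ji].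
by rewrite pderivX // (negPf ji) mulr0.
Qed.

Lemma shiftD_X1z N (z : int) : (0 < N)%N ->
  shiftD N (X 1 ^ z) = z%:~R * X 1 ^ (z - 1) * X 2.
Proof.
move=> N0; rewrite /shiftD big_ltn // pderiv1_X1z big_nat big1 => [|j /andP[j1 _]].
  by rewrite addr0 mulrC.
by rewrite (@pderiv_notin 1) ?mulr0 //; apply: in_vars_X1z.
Qed.

(** Derivatives in absent variables vanish, so every cutoff from [n] on computes the same D on
    [in_vars n]. *)
Lemma shiftD_widen n N P : (n <= N)%N -> in_vars n P -> shiftD N P = shiftD n P.
Proof.
move=> nN HP; rewrite /shiftD [LHS](@big_cat_nat _ _ _ n.+1) //=.
rewrite [X in _ + X]big_nat [X in _ + X]big1 ?addr0 // => j /andP[nj _].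
by rewrite (pderiv_notin nj HP) mulr0.
Qed.

Lemma in_vars_shiftD n P : in_vars n P -> in_vars n.+1 (shiftD n P).
Proof.
move=> HP; rewrite /shiftD big_nat; apply: in_vars_sum => j /andP[_ jn].
apply: in_vars_M; first exact: in_vars_X.
exact/in_vars_pderiv/(in_vars_mono (leqnSn n)).
Qed.

(** * The elements S and A: their variables and the recurrence of A *)

(** This turns the sum in the recurrence of S into [shiftD] at any larger cutoff, and bounds the
    values of the substitution that matter in (ii). *)
Lemma Spoly_in_vars n k : in_vars (n.+1 - k) (Spoly n k).
Proof.
elim: n k => [|n IH] [|k] /=.
- exact: in_vars_V.
- exact: in_vars0.
- exact: in_vars0.
- case: ltnP => [_|kn]; first exact: in_vars0.
  rewrite ltnS in kn; rewrite subSS; apply: in_vars_D.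
    (* For k = n the bound is 1 and excludes X_2, but then the factor S_(n,n+1) is 0. *)
    move: kn; rewrite leq_eqVlt => /orP[/eqP <-|kn].
      suff -> : Spoly k k.+1 = 0 by rewrite mulr0; apply: in_vars0.
      by case: (k) => //= i; rewrite ltnSn.
    apply: in_vars_M; last by apply: in_vars_mono (IH _); rewrite leq_sub2l.
    apply: in_vars_M; first by apply/in_vars_N/in_vars_int.
    by apply: in_vars_X; rewrite ltn_subRL addn1 ltnS.
  apply: in_vars_M; first by apply: in_vars_X; rewrite subn_gt0 ltnS.
  apply: in_vars_D; first exact: IH.
  rewrite subSn //; apply: in_vars_shiftD.
  by have := IH k.+1; rewrite subSS.
Qed.

Lemma Spoly_gt n k : (n < k)%N -> Spoly n k = 0.
Proof. by case: n k => [|n] [|k] //= ->; rewrite ?orbT. Qed.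

Lemma Apoly_gt n k : (n < k)%N -> Apoly n k = 0.
Proof. by move=> nk; rewrite /Apoly Spoly_gt // mulr0. Qed.

Lemma Apoly_0 n : Apoly n 0 = (n == 0%N)%:R.
Proof.
case: n => [|n]; rewrite /Apoly /= ?mulr0 //.
by rewrite expr1z divrr ?X1_unit.
Qed.

Lemma Apoly_in_vars n k : in_vars (n.+1 - k) (Apoly n k).
Proof.
case: (ltnP n k) => [nk|kn]; first by rewrite Apoly_gt //; apply: in_vars0.
apply: in_vars_M; last exact: Spoly_in_vars.
by apply: in_vars_X1z; rewrite subn_gt0.
Qed.

(** With S_(n,k) = X_1^(2n-1) A_(n,k), the product rule yields an extra term (2n-1) X_1^(2n-2) X_2
    A_(n,k); multiplied by X_1, it cancels -(2n-1) X_2 S_(n,k). The remaining powers of X_1 combine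
    to X_1^-1. *)
Lemma ApolyS n k N : (0 < k <= n.+1)%N -> (0 < N)%N -> (n.+1 - k <= N)%N ->
  Apoly n.+1 k = (X 1)^-1 * (Apoly n k.-1 + shiftD N (Apoly n k)).
Proof.
case: k => // k; rewrite /= ltnS => kn N0 nN.
have AE i : Spoly n i = X 1 ^ (2 * n%:Z - 1) * Apoly n i.
  by rewrite /Apoly mulrA -exprzDr ?X1_unit // subrr mul1r.
rewrite {1}/Apoly /= ltnNge ltnS kn /=.
have -> : \sum_(1 <= j < n.+2 - k.+1) X j.+1 * pderiv j (Spoly n k.+1)
          = shiftD N (Spoly n k.+1).
  rewrite subSS subSn // (shiftD_widen (n := n - k)) //.
  by have := Spoly_in_vars n k.+1; rewrite subSS.
have -> : - (2 * n.+1%:Z - 1) = - (2 * n%:Z - 1 + 1 + 1) :> int by rewrite intS; ring.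
rewrite !AE shiftDM shiftD_X1z //; move: (2 * n%:Z - 1) => z.
have zE : X 1 ^ z = X 1 ^ (z - 1) * X 1.
  by rewrite -{3}[X 1]expr1z -exprzDr ?X1_unit // subrK.
have : X 1 ^ (z - 1) \is a GRing.unit by rewrite unitrXz ?X1_unit.
(* Powers of X_1 become monomials in [w] = X_1^(2n-2) and X_1, so that the cancellation [key] is a
   polynomial identity. *)
move: (X 1 ^ (z - 1)) zE => w zE w_unit.
rewrite -invr_expz !exprzDr ?X1_unit // expr1z zE.
set c := z%:~R; set u := X 1; set a := Apoly n k.+1; set b := Apoly n k.
have uu : u \is a GRing.unit := X1_unit.
have key (R : comNzRingType) (c' u' w' x a' b' d : R) :
    - c' * x * (w' * u' * a') +
    u' * (w' * u' * b' + (c' * w' * x * a' + w' * u' * d)) =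
    w' * u' * u' * (b' + d) by ring.
rewrite key mulrA; congr (_ * _).
rewrite invrM ?unitrM ?w_unit ?uu //.
by rewrite -mulrA mulVr ?mulr1 // !unitrM w_unit uu.
Qed.

(** * The substitution phi, sending X_i to A_(i,1) *)

Definition Avar (i : nat) : laurent := Apoly i 1.

Lemma Avar1 : Avar 1 = (X 1)^-1.
Proof.
rewrite /Avar (@ApolyS 0 1 1) //= Apoly_0 Apoly_gt //.
by rewrite shiftD0 addr0 mulr1.
Qed.

Lemma Avar1_unit : Avar 1 \is a GRing.unit.
Proof. by rewrite Avar1 unitrV X1_unit. Qed.

Lemma AvarS i N : (0 < i <= N)%N -> Avar i.+1 = (X 1)^-1 * shiftD N (Avar i).
Proof.
case/andP=> i0 iN; rewrite /Avar (@ApolyS i 1 N) ?(leq_trans i0 iN) //.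
  by rewrite Apoly_0 gtn_eqF // add0r.
by rewrite subSS subn0.
Qed.

(** Both sides are derivations twisted by phi, so it suffices to compare them on the variables,
    where [AvarS] gives equality. *)
Lemma leval_Avar_shiftD n N P : (n <= N)%N -> in_vars n P ->
  leval Avar (shiftD N P) = (X 1)^-1 * shiftD N (leval Avar P).
Proof.
move=> nN HP; apply/eqP; rewrite -subr_eq0; apply/eqP; move: P HP.
apply: (@twisted_derivation_eq0 n (leval Avar)).
- exact/levalM/Avar1_unit.
- exact: leval1.
- move=> P Q; rewrite shiftD_additive !leval_additive shiftD_additive.
  by rewrite mulrDr opprD addrACA.
- move=> P Q; rewrite shiftDM leval_additive !levalM ?Avar1_unit // shiftDM.
  have key (R : comNzRingType) (x p p' q q' dp dq : R) :
    p' * q + p * q' - x * (dp * q + p * dq) =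
    (p' - x * dp) * q + p * (q' - x * dq) by ring.
  exact: key.
- move=> i /andP[i0 ilen]; have iN := leq_trans ilen nN.
  by rewrite shiftDX ?i0 // !levalX // (@AvarS _ N) ?i0 // subrr.
Qed.

(** Reduces the theorem to [Avar]: any [Y] with the same first values gives the same result. *)
Lemma leval_congr n Y Z P : Y 1%N \is a GRing.unit -> Z 1%N \is a GRing.unit ->
  (forall i, (0 < i <= n)%N -> Y i = Z i) -> in_vars n P -> leval Y P = leval Z P.
Proof.
move=> Yu Zu YZ.
apply: (ring_morph_eq (levalM Yu) (leval_additive Y) (leval1 Y)
                      (levalM Zu) (leval_additive Z) (leval1 Z)).
by move=> i /[dup] /YZ eYZ /andP[i0 _]; rewrite !levalX.
Qed.

Lemma leval_AvarK n P : in_vars n P -> leval Avar (leval Avar P) = P.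
Proof.
apply: (@ring_morph_eq n (leval Avar \o leval Avar) id).
- by move=> P1 Q /=; rewrite !(levalM Avar1_unit).
- by move=> P1 Q /=; rewrite !leval_additive.
- by rewrite /= !leval1.
- by [].
- by [].
- by [].
move=> i /andP[i0 _].
have X1V : leval Avar (X 1)^-1 = X 1.
  apply: (mulrI Avar1_unit); rewrite -[in LHS](levalX Avar (i := 1)) //.
  by rewrite -levalM ?Avar1_unit // divrr ?X1_unit // leval1 Avar1 mulVr ?X1_unit.
rewrite -[LHS]/(leval Avar (leval Avar (X i))).
elim: i i0 => // -[_ _|i IH _]; first by rewrite levalX // Avar1.
have IH' := IH isT; set j := i.+1 in IH' *; have jj : (0 < j <= j)%N by rewrite leqnn.
have jX : (0 < j.+1)%N by [].
(* phi phi X_(j+1) = phi(X_1^-1 D phi X_j) = X_1 X_1^-1 D phi phi X_j, which by induction is D X_j =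
   X_(j+1). *)
rewrite (levalX Avar jX) (AvarS jj) (levalM Avar1_unit) X1V.
rewrite (leval_Avar_shiftD (leqnn j)); last first.
  by have := Apoly_in_vars j 1; rewrite subSS subn0.
have {}jX : (0 < j)%N by [].
rewrite -[Avar j](levalX Avar jX) IH' (shiftDX jj).
exact/mulVKr/X1_unit.
Qed.

(** * Tools for the Bell polynomials: variables, exponents, coefficients *)

Lemma Bpoly_in_vars n k : in_vars (n.+1 - k) (Bpoly n k).
Proof.
rewrite /Bpoly; case: ifP => _; first exact: in_vars_nat.
case: ltnP => [_|kn]; first exact: in_vars0.
apply: in_vars_sum => r _; apply: in_vars_M; first exact: in_vars_nat.
apply: in_vars_prod => i _; apply/in_vars_exp/in_vars_X.
by rewrite subSn // (leq_trans (ltn_ord i)) // addn1.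
Qed.

Definition Xmon (i : nat) : lmonom :=
  match i with 0 => lmone | 1 => (1, mone) | j.+2 => (0, @ucm _ j) end.

Lemma XmonE i : (0 < i)%N -> X i = lterm 1 (Xmon i).
Proof. by case: i => [|[|i]]. Qed.

Lemma lmexp_Xmon i j : (0 < i)%N -> (0 < j)%N -> lmexp j (Xmon i) = (i == j)%:Z.
Proof.
case: i j => [|[|i]] [|[|j]] //= _ _; first by rewrite cm1.
by rewrite cmU !eqSS; case: eqVneq.
Qed.

Lemma lmexp_inj m1 m2 : (forall i, lmexp i.+1 m1 = lmexp i.+1 m2) -> m1 = m2.
Proof.
case: m1 m2 => [e1 m1] [e2 m2] E; congr (_, _); first exact: (E 0%N).
by apply/eqP/cmP => j; have [] := E j.+1.
Qed.

Lemma lmexp_ge0 i m : 0 <= m.1 -> 0 <= lmexp i m.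
Proof. by case: i => [|[|i]]. Qed.

Lemma lmexp_bounded m : exists N, forall i, (N <= i)%N -> lmexp i.+1 m = 0.
Proof.
(* [m.2 j] is the exponent at index [j.+1], so the largest occupied index is at most the maximum
   plus 1. *)
exists (\max_(j <- finsupp m.2) j).+2 => -[|i] //= Ni.
have [//|/eqP mi] := eqVneq (m.2 i) 0%N; first by move->.
have : i \in finsupp m.2 by rewrite -cmE_neq0; apply/eqP.
move=> /(@leq_bigmax_seq _ _ xpredT id)/(_ isT).
by rewrite leqNgt -ltnS Ni.
Qed.

Lemma lmdec_Xmon i m : (0 < i)%N -> lmdec i (lmmul m (Xmon i)) = m.
Proof.
move=> i0; rewrite lmmulC lmdecM ?lmexp_Xmon ?eqxx //.
suff -> : lmdec i (Xmon i) = lmone by rewrite lmmul1m.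
case: i i0 => [|[|i]] //= _; congr (_, _).
by apply/eqP/cmP => j; rewrite divcmE subnn cm1.
Qed.

Lemma lmdecK i m : (0 < i)%N -> lmexp i m != 0 -> lmmul (lmdec i m) (Xmon i) = m.
Proof. by move=> i0 mi; rewrite -lmdecM // lmdec_Xmon. Qed.

Lemma mcoeff_lterm c m m' : (lterm c m)@_m' = c *+ (m == m').
Proof. exact: mcoeffU. Qed.

Lemma mcoeff_lsum I (s : seq I) (p : pred I) (F : I -> laurent) m :
  (\sum_(i <- s | p i) F i)@_m = \sum_(i <- s | p i) (F i)@_m.
Proof. exact: raddf_sum. Qed.

Lemma lterm_intl (c d : int) m : c%:~R * lterm d m = lterm (c * d) m.
Proof. by rewrite ltermE [RHS]ltermE intrM mulrA. Qed.

Lemma mcoeff_natl (c : nat) (P : laurent) m : (c%:R * P)@_m = c%:Z * P@_m.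
Proof. by rewrite mulr_natl mcoeffMn -mulr_natl natz. Qed.

(** Under the derivative, [m] comes only from the monomial X_i m, whose exponent in X_i is one
    more. *)
Lemma mcoeff_pderiv i P m : (0 < i)%N ->
  (pderiv i P)@_m = (lmexp i m + 1) * P@_(lmmul m (Xmon i)).
Proof.
move=> i0; rewrite (laurentE P) pderiv_sum !mcoeff_lsum mulr_sumr.
apply: eq_bigr => m' _; rewrite pderivU lterm_intl !mcoeff_lterm.
have [->|mm'] := eqVneq m' (lmmul m (Xmon i)).
  by rewrite lmdec_Xmon // eqxx lmexpM lmexp_Xmon // eqxx mulrC.
(* If X_i does not occur in [m'], the factor 0 removes the term, so the junk value of [lmdec] does
   no harm. *)
rewrite mulr0; have [->|m'i] := eqVneq (lmexp i m') 0; first by rewrite mulr0 mul0rn.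
by case: eqVneq => // E; rewrite -E lmdecK ?eqxx // in mm'.
Qed.

(** Each monomial is an eigenvector of X_i d/dX_i, its exponent in X_i being the eigenvalue. *)
Lemma mcoeff_euler i P m : (0 < i)%N -> (X i * pderiv i P)@_m = lmexp i m * P@_m.
Proof.
move=> i0; rewrite (laurentE P) pderiv_sum mulr_sumr !mcoeff_lsum mulr_sumr.
apply: eq_bigr => m' _; rewrite pderivU lterm_intl XmonE // laurentUU mul1r.
rewrite !mcoeff_lterm lmmulC.
have [m'i|m'i] := eqVneq (lmexp i m') 0; last first.
  by rewrite lmdecK //; case: eqVneq => [->|]; rewrite ?mulr0 // mulrC.
by case: (eqVneq m' m) => [<-|_]; rewrite m'i ?mulr0 ?mul0r mul0rn.
Qed.

Lemma laurent_natI n (P Q : laurent) : n.+1%:R * P = n.+1%:R * Q -> P = Q.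
Proof.
move=> E; apply/malgP => m.
have := congr1 (mcoeff m) E; rewrite !mcoeff_natl.
exact: mulfI.
Qed.

(** * Partitions and the divisibility behind the Bell coefficients *)

Lemma big_ord_trunc (T : Type) (idx : T) (op : Monoid.law idx)
    (M N : nat) (F : nat -> T) :
    (forall i, (M <= i)%N -> F i = idx) -> (forall i, (N <= i)%N -> F i = idx) ->
  \big[op/idx]_(i < M) F i = \big[op/idx]_(i < N) F i.
Proof.
wlog MN : M N / (M <= N)%N.
  by move=> H FM FN; case: (leqP M N) => [|/ltnW] MN; [|symmetry]; apply: H.
move=> FM _; rewrite (big_ord_widen N F MN) big_mkcond; apply: eq_bigr => i _.
by case: ltnP => // /FM.
Qed.

(* A partition with r i parts of size i + 1, i < N. *)
Definition nparts (N : nat) (r : nat -> nat) : nat := \sum_(i < N) r i.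
Definition psize (N : nat) (r : nat -> nat) : nat := \sum_(i < N) i.+1 * r i.
(** The order of the stabilizer of a set partition of this type, so that ([psize])! / [psym] counts
    the set partitions of this type. *)
Definition psym (N : nat) (r : nat -> nat) : nat :=
  \prod_(i < N) ((r i)`! * i.+1`! ^ r i).

(** The quotient counts the partitions of (a+1)b points into b blocks of size a+1; the induction
    removes one block. *)
Lemma dvdn_fact_exp a b : (b`! * a.+1`! ^ b %| (a.+1 * b)`!)%N.
Proof.
elim: b => [|b IH]; first by rewrite muln0.
have le : (a.+1 <= a.+1 * b.+1)%N by rewrite leq_pmulr.
rewrite -(bin_fact le) mulnS addKn.
(* With M = (a+1)(b+1), this is (a+1) C(M,a+1) = M C(M-1,a) divided by a+1. *)
have -> : 'C(a.+1 + a.+1 * b, a.+1) = (b.+1 * 'C(a + a.+1 * b, a))%N.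
  apply/eqP; rewrite -(eqn_pmul2l (ltn0Sn a)) -mul_bin_diag mulnA -mulnS.
  by rewrite mulnS.
rewrite factS expnS.
have -> : (b.+1 * b`! * (a.+1`! * a.+1`! ^ b) =
           b.+1 * (a.+1`! * (b`! * a.+1`! ^ b)))%N by ring.
by rewrite -mulnA dvdn_mul // dvdn_mull // dvdn_mul.
Qed.

(** Makes the division in [Bpoly] exact. A binomial coefficient separates the points in blocks of
    size N+1 from the others. *)
Lemma psym_dvd N r : (psym N r %| (psize N r)`!)%N.
Proof.
elim: N => [|N IH]; first by rewrite /psym /psize !big_ord0.
rewrite /psym /psize !big_ord_recr /= -/(psym N r) -/(psize N r).
rewrite -(bin_fact (leq_addr (N.+1 * r N) (psize N r))) addKn.
by rewrite dvdn_mull // dvdn_mul // dvdn_fact_exp.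
Qed.

Lemma psym_gt0 N r : (0 < psym N r)%N.
Proof. by rewrite prodn_gt0 // => i; rewrite muln_gt0 expn_gt0 !fact_gt0. Qed.

(** With k parts of total size n, a part of size i+1 forces i <= n - k: this is why the variables of
    B_(n,k) stop at X_(n-k+1). *)
Lemma nparts_size N r i : (i < N)%N -> (nparts N r + i * r i <= psize N r)%N.
Proof.
move=> iN; have E : psize N r = (nparts N r + \sum_(j < N) j * r j)%N.
  by rewrite -big_split; apply: eq_bigr => j _; rewrite mulSn.
by rewrite E leq_add2l (bigD1 (Ordinal iN)) //= leq_addr.
Qed.

Lemma leq_nparts N r i : (i < N)%N -> (r i <= nparts N r)%N.
Proof. by move=> iN; rewrite /nparts (bigD1 (Ordinal iN)) //= leq_addr. Qed.

(** * Coefficients of the Bell polynomials *)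

(** The exponents as multiplicities of parts of size i+1. The absolute value hides a negative
    exponent of X_1, hence the separate condition [0 <= m.1] below. *)
Definition mexp (m : lmonom) (i : nat) : nat := `|lmexp i.+1 m|%N.

Lemma lterm_exp m k : exists2 m', lterm 1 m ^+ k = lterm 1 m' &
  forall j, lmexp j m' = lmexp j m * k%:Z.
Proof.
elim: k => [|k [m' E Em']].
  by exists lmone => // -[|[|j]] //=; rewrite ?cm1 !mulr0.
exists (lmmul m m'); first by rewrite exprS E laurentUU mulr1.
by move=> j; rewrite lmexpM Em' intS mulrDr mulr1.
Qed.

Lemma prodX_lterm N (r : nat -> nat) :
  exists2 m, \prod_(i < N) X i.+1 ^+ r i = lterm 1 m &
  forall j, lmexp j.+1 m = (if (j < N)%N then r j else 0%N)%:Z.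
Proof.
elim: N => [|N [m E Em]].
  by exists lmone; rewrite ?big_ord0 // => -[|j] //=; rewrite cm1.
have [m' E' Em'] := lterm_exp (Xmon N.+1) (r N).
exists (lmmul m m'); first by rewrite big_ord_recr /= E XmonE // E' laurentUU mulr1.
move=> j; rewrite lmexpM Em Em' lmexp_Xmon // eqSS ltnS.
by case: ltngtP => [||->]; rewrite ?mul0r ?mul1r ?addr0 ?add0r.
Qed.

(** At most one [r] in the defining sum matches the exponents of [m]. The bound [N] is free, so that
    Bell polynomials with different indices can be compared over one range. *)
Lemma mcoeff_Bpoly n k N m : (forall i, (N <= i)%N -> lmexp i.+1 m = 0) ->
  (Bpoly n k)@_m =
  if [&& 0 <= m.1, nparts N (mexp m) == k & psize N (mexp m) == n]
  then (n`! %/ psym N (mexp m))%N%:Z else 0.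
Proof.
move=> mN; have mexpN i : (N <= i)%N -> mexp m i = 0%N by move=> /mN; rewrite /mexp => ->.
rewrite /Bpoly; case: eqVneq => [->|k0].
  rewrite -[_%:R]mulr1 mcoeff_natl mcoeff_lterm.
  have [<-|m1] := eqVneq lmone m.
    have mexp0 i : mexp lmone i = 0%N by case: i => //= i; rewrite /mexp /= cm1.
    have -> : nparts N (mexp lmone) = 0%N by rewrite /nparts big1.
    have -> : psize N (mexp lmone) = 0%N.
      by rewrite /psize big1 // => i _; rewrite mexp0 muln0.
    have -> : psym N (mexp lmone) = 1%N.
      by rewrite /psym big1 // => i _; rewrite mexp0.
    by rewrite mulr1n mulr1 lexx eqxx; case: (n).
  rewrite mulr0; case: ifP => // /and3P[m0 /eqP np _].
  case/eqP: m1; apply: lmexp_inj => i.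
  have -> : lmexp i.+1 lmone = 0 by case: i => //= i; rewrite cm1.
  case: (ltnP i N) => [iN|/mN //].
  have := leq_nparts (mexp m) iN; rewrite np leqn0 /mexp absz_eq0.
  by move/eqP.
case: ltnP => [nk|kn].
  rewrite mcoeff0; case: ifP => // /and3P[_ /eqP np /eqP ps].
  suff : (k <= n)%N by rewrite leqNgt nk.
  rewrite -np -ps; apply: leq_sum => i _.
  by rewrite leq_pmull.
rewrite mcoeff_lsum; set K := (n - k + 1)%N.
pose fr (r : {ffun 'I_K -> 'I_k.+1}) i : nat := oapp (fun j => r j : nat) 0%N (insub i).
have frE r (i : 'I_K) : fr r i = r i by rewrite /fr valK.
have frK r i : (K <= i)%N -> fr r i = 0%N by move=> Ki; rewrite /fr insubF // ltnNge Ki.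
have npK (r : {ffun 'I_K -> 'I_k.+1}) : (\sum_i r i)%N = nparts K (fr r).
  by apply: eq_bigr => i _; rewrite frE.
have psK (r : {ffun 'I_K -> 'I_k.+1}) : (\sum_(i < K) i.+1 * r i)%N = psize K (fr r).
  by apply: eq_bigr => i _; rewrite frE.
have syK (r : {ffun 'I_K -> 'I_k.+1}) : 
    (\prod_(i < K) ((r i)`! * i.+1`! ^ r i))%N = psym K (fr r).
  by apply: eq_bigr => i _; rewrite frE.
have trunc (r : nat -> nat) M : (forall i, (M <= i)%N -> r i = 0%N) -> r =1 mexp m ->
  [/\ nparts M r = nparts N (mexp m), psize M r = psize N (mexp m) &
      psym M r = psym N (mexp m)].
  move=> rM rE; rewrite /nparts /psize /psym; split.
  - under eq_bigr do rewrite rE.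
    by apply: big_ord_trunc => // i Mi; rewrite -rE rM.
  - under eq_bigr do rewrite rE.
    apply: (@big_ord_trunc _ _ _ M N (fun i => i.+1 * mexp m i)%N) => i Mi;
      last by rewrite mexpN ?muln0.
    by rewrite -rE rM ?muln0.
  - under eq_bigr do rewrite rE.
    apply: (@big_ord_trunc _ _ _ M N
              (fun i => (mexp m i)`! * i.+1`! ^ mexp m i)%N) => i Mi; last by rewrite mexpN.
    by rewrite -rE rM.
have termE (r : {ffun 'I_K -> 'I_k.+1}) c :
    (c%:R * \prod_(i < K) X i.+1 ^+ r i)@_m =
    c%:Z *+ ((0 <= m.1) && [forall i : 'I_(maxn K N), fr r i == mexp m i]).
  have -> : \prod_(i < K) X i.+1 ^+ r i = \prod_(i < K) X i.+1 ^+ fr r i.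
    by apply: eq_bigr => i _; rewrite frE.
  have [m' -> Em'] := prodX_lterm K (fr r).
  rewrite mcoeff_natl mcoeff_lterm mulrnAr mulr1; congr (_ *+ _).
  have {}Em' j : lmexp j.+1 m' = (fr r j)%:Z.
    by rewrite Em'; case: ltnP => // /frK ->.
  congr nat_of_bool; apply/eqP/andP => [<-|[m0 /forallP E]].
    split; first by have := Em' 0%N => /= ->.
    by apply/forallP => i; rewrite /mexp Em'.
  apply: lmexp_inj => i; rewrite Em' -[RHS]gez0_abs ?lmexp_ge0 //; congr Posz.
  rewrite -/(mexp m i).
  case: (ltnP i (maxn K N)) => [iKN|]; first exact/eqP/(E (Ordinal iKN)).
  by rewrite geq_max => /andP[Ki Ni]; rewrite frK // mexpN.
under eq_bigr do rewrite termE syK.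
(* If the condition on [m] fails, no admissible [r] matches, since a matching [r] has the same
   number of parts and size as [m]. *)
rewrite -/K; case: ifP => [/and3P[m0 /eqP np /eqP ps]|cond]; last first.
  rewrite big1 // => r /andP[/eqP]; rewrite npK psK => np /eqP ps.
  case: andP => // -[m0 /forallP E]; move: cond; rewrite m0.
  have [||<- <- _] := trunc (fr r) K; rewrite ?np ?ps ?eqxx //; first exact: frK.
  move=> i; case: (ltnP i (maxn K N)) => [iKN|]; first exact/eqP/(E (Ordinal iKN)).
  by rewrite geq_max => /andP[Ki Ni]; rewrite frK // mexpN.
(* The bounds on [r] lose nothing: the exponents are at most k and vanish from index n - k + 1 on,
   so [r0] records them all. *)
have mexp_le i : (mexp m i <= k)%N.
  by case: (ltnP i N) => [iN|/mexpN ->//]; rewrite -np leq_nparts.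
have mexpK i : (K <= i)%N -> mexp m i = 0%N.
  move=> Ki; case: (ltnP i N) => [iN|/mexpN //].
  have := nparts_size (mexp m) iN; rewrite np ps -leq_subRL //.
  case: (mexp m i) => // a; rewrite mulnS => /(leq_trans (leq_addr _ _)) /(leq_trans Ki).
  by rewrite /K addn1 ltnn.
pose r0 : {ffun 'I_K -> 'I_k.+1} := [ffun i : 'I_K => inord (mexp m i)].
have fr0 : fr r0 =1 mexp m.
  move=> i; case: (ltnP i K) => [iK|Ki]; last by rewrite frK ?mexpK.
  by rewrite (frE r0 (Ordinal iK)) ffunE inordK // ltnS.
have [npr psr syr] := trunc (fr r0) K (@frK r0) fr0.
rewrite (bigD1 r0) /=; last by rewrite npK psK npr psr np ps !eqxx.
have -> : [forall i : 'I_(maxn K N), fr r0 i == mexp m i].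
  by apply/forallP => i; rewrite fr0.
rewrite m0 mulr1n syr big1 ?addr0 // => r /andP[_ rr0].
case: forallP => // E; case/eqP: rr0; apply/ffunP => i; apply: val_inj.
have iKN : (i < maxn K N)%N by rewrite leq_max ltn_ord.
by rewrite /= -!frE fr0; apply/eqP/(E (Ordinal iKN)).
Qed.

(** * Derivatives and recurrence of the Bell polynomials *)

(** If e is the exponent of X_(i+1) in [m], one more part of size i+1 multiplies [psym] by (e+1)
    (i+1)!. The derivative supplies e+1, and n! = C(n,i+1) (i+1)! (n-i-1)! does the rest. *)
Lemma pderiv_Bpoly i n k :
  pderiv i.+1 (Bpoly n k.+1) = 'C(n, i.+1)%:R * Bpoly (n - i.+1) k.
Proof.
apply/malgP => m; rewrite mcoeff_pderiv // mcoeff_natl.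
have [N0 mN0] := lmexp_bounded m; pose N := maxn N0 i.+1.
have iN : (i < N)%N by rewrite leq_max leqnn orbT.
have mN j : (N <= j)%N -> lmexp j.+1 m = 0.
  by rewrite geq_max => /andP[/mN0].
set m' := lmmul m (Xmon i.+1).
have m'E j : lmexp j.+1 m' = lmexp j.+1 m + (i == j)%:Z.
  by rewrite lmexpM lmexp_Xmon // eqSS.
have m'N j : (N <= j)%N -> lmexp j.+1 m' = 0.
  by move=> Nj; rewrite m'E mN // ltn_eqF // (leq_trans iN).
rewrite (mcoeff_Bpoly n k.+1 m'N) (mcoeff_Bpoly (n - i.+1) k mN).
have m'1 : m'.1 = m.1 + (i == 0%N)%:Z := m'E 0%N.
(* If X_1 has a negative exponent in [m], the left side can survive only for i = 0 and exponent -1,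
   where the factor from the derivative is 0. *)
have [m0|m0] := leP 0 m.1; last first.
  rewrite mulr0; case: ifP => [/andP[m'0 _]|]; last by rewrite mulr0.
  move: m'0; rewrite m'1; case: (i) => [|i'] /= m1; last first.
    by rewrite addr0 leNgt m0 in m1.
  suff -> : m.1 + 1 = 0 by rewrite mul0r.
  by apply/eqP; rewrite eq_le lezD1 m0 m1.
have me i' : lmexp i'.+1 m = (mexp m i')%:Z by rewrite gez0_abs ?lmexp_ge0.
have m'e j : mexp m' j = (mexp m j + (i == j))%N by rewrite /mexp m'E me.
pose o := Ordinal iN.
have m'o (j : 'I_N) : j != o -> mexp m' j = mexp m j.
  by move=> jo; rewrite m'e eq_sym (_ : (j == i :> nat) = false) ?addn0 //; apply/negbTE.
have npE : nparts N (mexp m') = (nparts N (mexp m)).+1.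
  rewrite /nparts !(bigD1 o (P := xpredT)) //= m'e eqxx addn1 addSn; congr (_ + _).+1.
  exact: eq_bigr.
have psE : psize N (mexp m') = (psize N (mexp m) + i.+1)%N.
  rewrite /psize !(bigD1 o (P := xpredT)) //= m'e eqxx addn1 mulnS -addnA.
  rewrite [RHS]addnC; congr (_ + (_ + _))%N.
  by apply: eq_bigr => j /m'o ->.
have syE : psym N (mexp m') = (psym N (mexp m) * ((mexp m i).+1 * i.+1`!))%N.
  rewrite /psym !(bigD1 o (P := xpredT)) //= m'e eqxx addn1 factS expnS.
  under eq_bigr => j /m'o -> do [].
  have ac (u v w f p : nat) : (u * v * (f * w) * p = v * w * p * (u * f))%N by ring.
  exact: ac.
have dvd' := psym_dvd N (mexp m'); have dvd := psym_dvd N (mexp m).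
have m'0 : 0 <= m'.1 by rewrite m'1 addr_ge0.
rewrite m'0 npE eqSS me /=; case: eqVneq => _; last by rewrite !mulr0.
(* For n < i+1 the subtraction [n - i.+1] is truncated to 0, but the binomial coefficient is 0. *)
case: (leqP i.+1 n) => /= ni; last first.
  rewrite bin_small // mul0r psE gtn_eqF ?mulr0 //.
  by rewrite (leq_trans ni) // leq_addl.
have -> : (psize N (mexp m') == n) = (psize N (mexp m) == n - i.+1)%N.
  by rewrite psE -(eqn_add2r i.+1 _ (n - i.+1)) subnK.
case: eqVneq => [ps|_]; last by rewrite !mulr0.
rewrite psE ps subnK // in dvd'; rewrite ps in dvd.
case/dvdnP: dvd' => q' q'E; case/dvdnP: dvd => q qE.
rewrite q'E qE !mulnK ?psym_gt0 // -[1]/(1%:Z) -PoszD -!PoszM addn1; congr Posz.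
have /eqP := bin_fact ni; rewrite q'E qE syE => /eqP E.
apply/eqP; rewrite -(eqn_pmul2r (psym_gt0 N (mexp m))) -(eqn_pmul2r (fact_gt0 i.+1)).
have ac (u v w f : nat) : (u * v * w * f = v * (w * (u * f)))%N by ring.
have ac' (u v w f : nat) : (u * v * w * f = u * (f * (v * w)))%N by ring.
by rewrite ac ac' E.
Qed.

(** B_(n,k) is homogeneous of weight n when X_i has weight i. *)
Lemma Bpoly_euler N n k : (n <= N)%N ->
  \sum_(i < N) i.+1%:R * (X i.+1 * pderiv i.+1 (Bpoly n k)) = n%:R * Bpoly n k.
Proof.
move=> nN; apply/malgP => m; rewrite mcoeff_lsum mcoeff_natl.
under eq_bigr do rewrite mcoeff_natl mcoeff_euler // mulrA.
rewrite -mulr_suml; have [N0 mN0] := lmexp_bounded m.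
rewrite (mcoeff_Bpoly n k mN0); case: ifP => [/and3P[m0 _ /eqP ps]|];
  last by rewrite !mulr0.
congr (_ * _); rewrite -ps /psize -natz natr_sum.
have mE i : lmexp i.+1 m = (mexp m i)%:Z by rewrite gez0_abs ?lmexp_ge0.
under [RHS]eq_bigr do rewrite natz PoszM -mE.
(* Since the total size is n, a nonzero exponent at index i forces i < n <= N, so neither cutoff
   loses a term. *)
apply: (@big_ord_trunc _ _ _ N N0 (fun i => i.+1%:Z * lmexp i.+1 m)) => i Ni; last first.
  by rewrite mN0 // mulr0.
rewrite mE; case: (ltnP i N0) => [iN0|/mN0]; last by rewrite mE => ->; rewrite mulr0.
have := nparts_size (mexp m) iN0; have := leq_nparts (mexp m) iN0; rewrite ps.
case: (mexp m i) => [|e]; first by rewrite mulr0.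
move=> le1 le2; have : (i < n)%N.
  apply: leq_trans le2; rewrite -addn1 addnC leq_add //; first exact: leq_trans le1.
  by rewrite leq_pmulr.
by rewrite ltnNge (leq_trans nN Ni).
Qed.

(** In the Euler identity for B_(n+1,k+1), (i+1) C(n+1,i+1) = (n+1) C(n,i) gives every term a factor
    n+1, which cancels. The term i = 0 is X_1 B_(n,k); for i >= 1, C(n,i) B_(n-i,k) is the
    derivative of B_(n,k+1) in X_i, and these terms sum to D B_(n,k+1). *)
Lemma BpolyS n k N : (n <= N)%N ->
  Bpoly n.+1 k.+1 = X 1 * Bpoly n k + shiftD N (Bpoly n k.+1).
Proof.
move=> nN; apply: (@laurent_natI n).
have E i : i.+1%:R * (X i.+1 * pderiv i.+1 (Bpoly n.+1 k.+1)) =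
           n.+1%:R * (X i.+1 * ('C(n, i)%:R * Bpoly (n - i) k)).
  rewrite pderiv_Bpoly subSS.
  have ac (R : comNzRingType) (a b c d : R) : a * (b * (c * d)) = a * c * (b * d) by ring.
  by rewrite !ac -!natrM mul_bin_diag.
rewrite -(@Bpoly_euler N.+1) //; under eq_bigr => i _ do rewrite E.
rewrite -mulr_sumr big_ord_recl; congr (_ * _); congr (_ + _).
  by rewrite bin0 mul1r subn0.
rewrite /shiftD big_add1 big_mkord; apply: eq_bigr => i _.
by rewrite pderiv_Bpoly.
Qed.

Lemma Bpoly_0 n : Bpoly n 0 = (n == 0%N)%:R.
Proof. by []. Qed.

Lemma Bpoly_gt n k : (n < k)%N -> Bpoly n k = 0.
Proof. by case: k => // k nk; rewrite /Bpoly /= nk. Qed.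

(** * The two inversion identities *)

Lemma Apoly_leval n k : Apoly n k = leval Avar (Bpoly n k).
Proof.
have leval0 : leval Avar 0 = 0.
  by apply: (addrI (leval Avar 0)); rewrite -leval_additive !addr0.
have A0 i : Apoly i 0 = leval Avar (Bpoly i 0).
  by rewrite Apoly_0 Bpoly_0; case: eqP => _; rewrite ?leval0 ?leval1.
elim: n k => [|n IH] [|k]; rewrite ?A0 //.
  by rewrite Apoly_gt // Bpoly_gt.
case: (ltnP n k) => [nk|kn]; first by rewrite Apoly_gt // Bpoly_gt.
(* The common cutoff is n+1 and not n, so that it is positive for n = 0 too. *)
have nN : (n.+1 - k.+1 <= n.+1)%N by rewrite leq_subr.
rewrite (ApolyS _ _ nN) // !IH (BpolyS k (leqnSn n)).
rewrite leval_additive (levalM Avar1_unit) (levalX Avar (ltn0Sn 0)) Avar1.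
by rewrite (leval_Avar_shiftD nN (Bpoly_in_vars n k.+1)) mulrDr.
Qed.

Theorem theorem5p3 (n k : nat) (hk : (1 <= k <= n)%N) :
  (forall Y : nat -> laurent,
     (forall i : nat, (1 <= i <= n - k + 1)%N -> Y i = Apoly i 1) ->
     Apoly n k = leval Y (Bpoly n k)) /\
  (forall Y : nat -> laurent,
     (forall i : nat, (1 <= i <= n - k + 1)%N -> Y i = Apoly i 1) ->
     Bpoly n k = leval Y (Apoly n k)).
Proof.
case/andP: hk => _ kn; rewrite addn1 -subSn //.
have congY Y P : (forall i, (1 <= i <= n.+1 - k)%N -> Y i = Apoly i 1) ->
    in_vars (n.+1 - k) P -> leval Y P = leval Avar P.
  move=> YA; apply: leval_congr => //; last exact: Avar1_unit.
  (* As k <= n, the index 1 is in range, so [Y 1] is the unit A_(1,1). *)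
  by rewrite YA ?subn_gt0 //; exact: Avar1_unit.
split=> Y YA; rewrite (congY Y _ YA).
- exact: Apoly_leval.
- exact: Bpoly_in_vars.
(* A_(n,k) is phi(B_(n,k)), and a second phi returns B_(n,k). *)
- by rewrite Apoly_leval (leval_AvarK (Bpoly_in_vars n k)).
- exact: Apoly_in_vars.
Qed.
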